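(* Let $\mathcal A$ and $\mathcal B$ be countable structures with domain $\omega$. For every continuous isomorphism $H\colon \mathrm{Aut}(\mathcal B)\to\mathrm{Aut}(\mathcal A)$, there is a Borel adjoint equivalence of categories $F\colon \mathrm{Iso}(\mathcal B)\to\mathrm{Iso}(\mathcal A)$ (together with some $G\colon\mathrm{Iso}(\mathcal A)\to\mathrm{Iso}(\mathcal B)$ and natural isomorphisms $\eta,\epsilon$) with $F(\mathcal B)=\mathcal A$ and whose restriction to $\mathrm{Aut}(\mathcal B)$ is $H$.
   Context: All structures are countable, in computable relational signatures, with domain $\omega$. For a structure $\mathcal A$, $\mathrm{Iso}(\mathcal A)=\{\hat{\mathcal A}:\hat{\mathcal A}\cong\mathcal A,\ \mathrm{dom}(\hat{\mathcal A})=\omega\}$ is regarded as a category whose objects are these copies and whose morphisms are the isomorphisms between them; $\mathrm{Aut}(\mathcal A)$ is the automorphism group of the fixed presentation $\mathcal A$, viewed as a closed subgroup of $S_\infty$ with its Polish topology. A functor $F\colon\mathrm{Iso}(\mathcal B)\to\mathrm{Iso}(\mathcal A)$ assigns to each copy $\hat{\mathcal B}$ a copy $F(\hat{\mathcal B})$ and to each isomorphism $f\colon\hat{\mathcal B}\to\tilde{\mathcal B}$ an isomorphism $F(f)\colon F(\hat{\mathcal B})\to F(\tilde{\mathcal B})$, preserving identities and composition; it is Borel if given by a pair of Borel operators $2^\omega\to 2^\omega$. Functors $F\colon\mathrm{Iso}(\mathcal B)\to\mathrm{Iso}(\mathcal A)$ and $G\colon\mathrm{Iso}(\mathcal A)\to\mathrm{Iso}(\mathcal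 B)$ together with families of isomorphisms $\epsilon_{\tilde{\mathcal A}}\colon\tilde{\mathcal A}\to F(G(\tilde{\mathcal A}))$ and $\eta_{\tilde{\mathcal B}}\colon\tilde{\mathcal B}\to G(F(\tilde{\mathcal B}))$ (natural isomorphisms from the identity functors to $FG$ and $GF$) form an adjoint equivalence of categories if $F(\eta_{\hat{\mathcal B}})=\epsilon_{F(\hat{\mathcal B})}$ and $G(\epsilon_{\hat{\mathcal A}})=\eta_{G(\hat{\mathcal A})}$; it is Borel if $F,G,\eta,\epsilon$ are Borel operators. The restriction of $F$ to $\mathrm{Aut}(\mathcal B)$ (when $F(\mathcal B)=\mathcal A$) is the map $h\mapsto F(h)$ from $\mathrm{Aut}(\mathcal B)$ to $\mathrm{Aut}(\mathcal A)$. *)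

(* Defs.v *)
From mathcomp Require Import all_boot.
From mathcomp Require Import all_classical all_analysis.

Set Implicit Arguments.
Unset Strict Implicit.
Unset Printing Implicit Defensive.

Local Open Scope classical_set_scope.

(* The total recursive functions of each arity.  Minimization is restricted to
   regular functions; by Kleene's normal form theorem this yields exactly the
   total computable functions. *)
Inductive recursive : forall n : nat, (n.-tuple nat -> nat) -> Prop :=
| recursive_zero : recursive (fun _ : 0.-tuple nat => 0)
| recursive_succ : recursive (fun t : 1.-tuple nat => (thead t).+1)
| recursive_proj n (i : 'I_n) : recursive (fun t : n.-tuple nat => tnth t i)
| recursive_comp m n (g : m.-tuple nat -> nat) (h : 'I_m -> n.-tuple nat -> nat) :
    recursive g -> (forall i, recursive (h i)) ->
    recursive (fun t : n.-tuple nat => g [tuple h i t | i < m])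
| recursive_primrec n (g : n.-tuple nat -> nat) (h : n.+2.-tuple nat -> nat) :
    recursive g -> recursive h ->
    recursive (fun t : n.+1.-tuple nat =>
      iteri (thead t) (fun k r => h [tuple of k :: r :: behead t])
        (g [tuple of behead t]))
| recursive_min n (g : n.+1.-tuple nat -> nat) (f : n.-tuple nat -> nat) :
    recursive g ->
    (forall t, g [tuple of f t :: t] = 0 /\
               forall k, k < f t -> g [tuple of k :: t] <> 0) ->
    recursive f.

Definition computable (f : nat -> nat) : Prop :=
  recursive (fun t : 1.-tuple nat => f (thead t)).

(* Relation symbols are the elements of a computable, possibly finite, set of
   natural numbers; the value of [arity] outside that set is irrelevant. *)
Record signature := Signature {
  is_symbol : pred nat;
  arity : nat -> nat;
  computable_is_symbol : computable (fun i => is_symbol i);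
  computable_arity : computable arity
}.

Definition symbol (L : signature) : Type := {i : nat | is_symbol L i}.

Definition symbol_arity (L : signature) (R : symbol L) : nat := arity L (val R).

(* Structures with domain nat. *)
Definition structure (L : signature) : Type :=
  forall R : symbol L, (symbol_arity R).-tuple nat -> bool.

(* A set of points of the Baire space: [automorphisms] below thus carries the
   subspace topology, which is its topology as a closed subgroup of the
   permutation group of nat. *)
Definition isos (L : signature) (X Y : structure L) : set {ptws nat -> nat} :=
  [set f : nat -> nat | bijective f /\
    forall (R : symbol L) (t : (symbol_arity R).-tuple nat),
      Y R (map_tuple f t) = X R t].

Definition automorphisms (L : signature) (X : structure L) := set_type (isos X X).

Lemma isos_id (L : signature) (X : structure L) : (id : nat -> nat) \in isos X X.
Proof.
rewrite inE; split; first by exists id.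
by move=> R t; congr (X R _); apply: val_inj; rewrite /= map_id.
Qed.

Lemma isos_comp (L : signature) (X Y Z : structure L)
    (g : isos Y Z) (f : isos X Y) : (val g \o val f : nat -> nat) \in isos X Z.
Proof.
case: g f => [g /= +] [f /= +]; rewrite !inE => -[bg pg] [bf pf].
split; first exact: bij_comp bg bf.
move=> R t; rewrite -pf -pg; congr (Z R _); apply: val_inj.
by rewrite /= map_comp.
Qed.

Definition iso_id (L : signature) (X : structure L) : isos X X :=
  exist _ (id : nat -> nat) (isos_id X).

Definition iso_comp (L : signature) (X Y Z : structure L)
    (g : isos Y Z) (f : isos X Y) : isos X Z :=
  exist _ (val g \o val f : nat -> nat) (isos_comp g f).

Definition isomorphic (L : signature) (X Y : structure L) : Prop :=
  isos X Y !=set0.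

(* Objects of the category Iso(A). *)
Definition Iso (L : signature) (A : structure L) : Type :=
  set_type [set X : structure L | isomorphic X A].

Lemma isomorphic_refl (L : signature) (A : structure L) :
  A \in [set X : structure L | isomorphic X A].
Proof. by rewrite inE; exists id; have := isos_id A; rewrite inE. Qed.

Definition Iso_self (L : signature) (A : structure L) : Iso A :=
  exist _ A (isomorphic_refl A).

Definition struct_of (L : signature) (A : structure L) (X : Iso A) : structure L :=
  val X.
Coercion struct_of : Iso >-> structure.

Record functor (LB LA : signature) (B : structure LB) (A : structure LA) := Functor {
  functor_obj :> Iso B -> Iso A;
  functor_map : forall X Y : Iso B, isos X Y -> isos (functor_obj X) (functor_obj Y);
  functor_id : forall X : Iso B, functor_map (iso_id X) = iso_id (functor_obj X);
  functor_comp : forall (X Y Z : Iso B) (g : isos Y Z) (f : isos X Y),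
    functor_map (iso_comp g f) = iso_comp (functor_map g) (functor_map f)
}.

Record adjoint_equivalence (LB LA : signature)
    (B : structure LB) (A : structure LA) := AdjointEquivalence {
  functorF : functor B A;
  functorG : functor A B;
  eps : forall X : Iso A, isos X (functorF (functorG X));
  eta : forall X : Iso B, isos X (functorG (functorF X));
  eps_natural : forall (X Y : Iso A) (f : isos X Y),
    iso_comp (functor_map functorF (functor_map functorG f)) (eps X) = iso_comp (eps Y) f;
  eta_natural : forall (X Y : Iso B) (f : isos X Y),
    iso_comp (functor_map functorG (functor_map functorF f)) (eta X) = iso_comp (eta Y) f;
  functorF_eta : forall X : Iso B, functor_map functorF (eta X) = eps (functorF X);
  functorG_eps : forall X : Iso A, functor_map functorG (eps X) = eta (functorG X)
}.

(* Atomic sentences R(t) and pairs (x, y) are numbered by [pickle]; numbers that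
   code nothing get the value [false]. *)
Definition diagram (L : signature) (X : structure L) : cantor_space :=
  fun n => if @unpickle {R : symbol L & (symbol_arity R).-tuple nat} n
           is Some (existT R t) then X R t else false.

Definition graph_code (f : nat -> nat) : cantor_space :=
  fun n => if @unpickle (nat * nat)%type n is Some (x, y) then f x == y else false.

Definition real_join (x y : cantor_space) : cantor_space :=
  fun n => if odd n then y n./2 else x n./2.

Definition borel_operator (Phi : cantor_space -> cantor_space) : Prop :=
  measurable_fun [set: g_sigma_algebraType (@open cantor_space)]
    (Phi : g_sigma_algebraType (@open cantor_space) ->
           g_sigma_algebraType (@open cantor_space)).

Definition borel_functor (LB LA : signature) (B : structure LB)
    (A : structure LA) (F : functor B A) : Prop :=
  exists Phi Phi_star : cantor_space -> cantor_space,
    [/\ borel_operator Phi, borel_operator Phi_star,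
        forall X : Iso B, Phi (diagram X) = diagram (F X) &
        forall (X Y : Iso B) (f : isos X Y),
          Phi_star (real_join (real_join (diagram X) (graph_code (val f))) (diagram Y))
          = graph_code (val (functor_map F f))].

Definition borel_isos (L : signature) (A : structure L) (T : Iso A -> Iso A)
    (tau : forall X : Iso A, isos X (T X)) : Prop :=
  exists Lambda : cantor_space -> cantor_space, borel_operator Lambda /\
    forall X : Iso A, Lambda (diagram X) = graph_code (val (tau X)).

Definition borel_adjoint_equivalence (LB LA : signature) (B : structure LB)
    (A : structure LA) (E : adjoint_equivalence B A) : Prop :=
  [/\ borel_functor (functorF E), borel_functor (functorG E),
      borel_isos (T := fun X => functorF E (functorG E X)) (eps E) &
      borel_isos (T := fun X => functorG E (functorF E X)) (eta E)].

Definition continuous_isomorphism (LB LA : signature) (B : structure LB)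
    (A : structure LA) (H : automorphisms B -> automorphisms A) : Prop :=
  [/\ {morph H : g f / iso_comp g f}, bijective H & continuous H].

(* Main.v *)
(** Both functors are constant on objects.  For each copy [X] of [B] one selects,
in a Borel way, an isomorphism [s X : B -> X] with [s B = id], and likewise
[r Y : A -> Y]; then [F f = H ((s Y)^-1 f (s X))], [G] is built in the same way
from [H^-1] and [r], and the units are the inverses of [s] and [r].

The selection is a back-and-forth construction, with least choices, between [B]
and [X], preserving all isomorphism-invariant Borel properties of tuples.
Agreement of two tuples of [B] on these properties has the extension property,
because the properties are closed under countable conjunction and quantification,
and countably many of them isolate each class; no ordinal ranks are needed.

For [G] to be Borel, [H^-1] has to be continuous.  By Baire category the closure
of the image of the stabilizer [V] of a finite set contains a neighbourhood of the
identity.  Each small [y] then lies in [H V (H V)^-1]: one constructs [a] and [b]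
in [V] with [y (H b) = H a] by successive approximation. *)

Require Import Defs.
From mathcomp Require Import all_boot.
From mathcomp Require Import all_classical all_analysis.

Set Implicit Arguments.
Unset Strict Implicit.
Unset Printing Implicit Defensive.

Local Open Scope classical_set_scope.

(** * Prefix neighbourhoods *)

(** Prefix sets form a filter base converging pointwise to [x]. The general [T] covers both Baire
    and Cantor space. *)
Lemma ptws_nbhs_prefix (T : uniformType) (x : {ptws nat -> T})
    (U : set {ptws nat -> T}) :
  nbhs x U ->
  exists n, forall y : nat -> T, (forall i, i < n -> y i = x i) -> U y.
Proof.
pose F := filter_from [set: nat]
  (fun n => [set y : nat -> T | forall i, i < n -> y i = x i]).
have FF : Filter F.
  apply: filter_from_filter; first by exists 0.
  move=> m n _ _; exists (maxn m n) => // y yx.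
  by split=> i ltin; apply: yx; rewrite leq_max ltin ?orbT.
suff : {ptws, F --> x} by move=> /(_ U) h /h[n _ nU]; exists n => y /nU.
apply/pointwise_cvgP => t V /= Vt; exists t.+1 => // y /(_ t (ltnSn t)) yt.
by rewrite /= yt; exact: nbhs_singleton.
Qed.

Lemma prefix_nbhs (x : {ptws nat -> nat}) n :
  nbhs x [set y | forall i, i < n -> y i = x i].
Proof.
elim: n => [|n IH]; first by apply: filterS filterT.
have xn : nbhs x [set y | y n = x n].
  exact: (@proj_continuous nat (fun=> nat) n x _ (discrete_set1 (x n))).
apply: filterS (filterI IH xn) => y [yx yn] i.
by rewrite ltnS leq_eqVlt => /predU1P[->//|/yx].
Qed.

Lemma automorphisms_nbhs_prefix (L : signature) (X : structure L)
    (x : automorphisms X) (U : set (automorphisms X)) :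
  nbhs x U -> exists n, forall y : automorphisms X,
    (forall i, i < n -> val y i = val x i) -> U y.
Proof.
rewrite nbhsE => -[V [[W oW <-] Wx] VU].
have [|n nW] := @ptws_nbhs_prefix _ (val x) W; first exact: open_nbhs_nbhs.
by exists n => y yx; apply: VU; apply: nW.
Qed.

Lemma continuous_prefix (LB LA : signature) (B : structure LB)
    (A : structure LA) (H : automorphisms B -> automorphisms A)
    (g : automorphisms B) n :
  {for g, continuous H} ->
  exists m, forall f : automorphisms B, (forall i, i < m -> val f i = val g i) ->
    forall i, i < n -> val (H f) i = val (H g) i.
Proof.
move=> cH.
have cval : continuous (val : automorphisms A -> {ptws nat -> nat}).
  exact: initial_continuous.
have := @prefix_nbhs (val (H g)) n.
by move=> /(cval (H g)) /= /cH /automorphisms_nbhs_prefix[m mU]; exists m => f /mU.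
Qed.

(** * The groupoid of isomorphisms *)

Lemma iso_ext (L : signature) (X Y : structure L) (f g : isos X Y) :
  val f =1 val g -> f = g.
Proof. by move=> fg; apply: val_inj; apply/funext. Qed.

Lemma iso_invK (L : signature) (X Y : structure L) (f : isos X Y) :
  exists g : isos Y X, cancel (val f) (val g) /\ cancel (val g) (val f).
Proof.
case: f => f /= fP; move: (fP); rewrite inE => -[[g fK gK] fR].
have gP : (g : nat -> nat) \in isos Y X.
  rewrite inE; split; first by exists f.
  move=> R t; rewrite -fR; congr (Y R _); apply: val_inj.
  by rewrite /= -map_comp map_id_in // => y _ /=; rewrite gK.
by exists (exist _ g gP).
Qed.

Definition iso_inv (L : signature) (X Y : structure L) (f : isos X Y) : isos Y X :=
  sval (cid (iso_invK f)).

Lemma isoK (L : signature) (X Y : structure L) (f : isos X Y) :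
  cancel (val f) (val (iso_inv f)).
Proof. by rewrite /iso_inv; case: cid => g []. Qed.

Lemma isoVK (L : signature) (X Y : structure L) (f : isos X Y) :
  cancel (val (iso_inv f)) (val f).
Proof. by rewrite /iso_inv; case: cid => g []. Qed.

Lemma iso_inv_id (L : signature) (X : structure L) :
  iso_inv (iso_id X) = iso_id X.
Proof. by apply: iso_ext => x; exact: (isoVK (iso_id X)). Qed.

Lemma iso_rel (L : signature) (X Y : structure L) (f : isos X Y)
    (R : symbol L) (t : (symbol_arity R).-tuple nat) :
  Y R (map_tuple (val f) t) = X R t.
Proof. by case: f => f /= fP; move: (fP); rewrite inE => -[_]; apply. Qed.

(** * Automatic continuity of the inverse *)

(* A neighbourhood of [f] in the two-sided uniformity, which, unlike the
   one-sided one, is complete. *)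
Definition agree (L : signature) (X : structure L) k (f g : automorphisms X) :=
  forall x, x < k ->
    val g x = val f x /\ val (iso_inv g) x = val (iso_inv f) x.

Lemma agree_refl (L : signature) (X : structure L) k (f : automorphisms X) :
  agree k f f.
Proof. by []. Qed.

Lemma agree_trans (L : signature) (X : structure L) k (g f h : automorphisms X) :
  agree k f g -> agree k g h -> agree k f h.
Proof.
by move=> fg gh x xk; have [-> ->] := gh x xk; have [-> ->] := fg x xk.
Qed.

Lemma agreeW (L : signature) (X : structure L) k k' (f g : automorphisms X) :
  k <= k' -> agree k' f g -> agree k f g.
Proof. by move=> kk fg x /leq_trans/(_ kk)/fg. Qed.

(** Completeness: [i <= k i] freezes every point, forwards and backwards, at some stage, so the two
    limits are mutually inverse; an atomic relation involves only finitely many points. *)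
Lemma agree_limit (L : signature) (X : structure L) (f : nat -> automorphisms X)
    (k : nat -> nat) :
  (forall i, i <= k i) -> (forall i, k i <= k i.+1) ->
  (forall i, agree (k i) (f i) (f i.+1)) ->
  exists g, forall i, agree (k i) (f i) g.
Proof.
move=> ki kS fS.
have kM := homo_leq leqnn leq_trans kS.
have fM i j : i <= j -> agree (k i) (f i) (f j).
  move=> ij; rewrite -(subnKC ij); elim: (j - i) => [|d IH].
    by rewrite addn0; exact: agree_refl.
  rewrite addnS; apply: agree_trans IH _; apply: agreeW (fS _).
  by apply: kM; rewrite leq_addr.
(* Stage [x.+1] is the first one at which [i <= k i] guarantees that [x] is frozen. *)
pose g x := val (f x.+1) x; pose h x := val (iso_inv (f x.+1)) x.
have gE i x : x < k i -> g x = val (f i) x /\ h x = val (iso_inv (f i)) x.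
  move=> xi; pose j := maxn i x.+1.
  have [E1 E2] := fM i j (leq_maxl _ _) x xi.
  have [E3 E4] := fM x.+1 j (leq_maxr _ _) x (leq_trans (ltnSn x) (ki _)).
  by rewrite /g /h -E1 -E2 -E3 -E4.
have hK : cancel g h.
  move=> x; pose i := maxn x.+1 (g x).+1.
  have [gx _] : g x = val (f i) x /\ h x = val (iso_inv (f i)) x.
    by apply: gE; apply: leq_trans (ki _); rewrite leq_max leqnn.
  have [_ ->] : g (g x) = val (f i) (g x) /\ h (g x) = val (iso_inv (f i)) (g x).
    by apply: gE; apply: leq_trans (ki _); rewrite leq_max leqnn orbT.
  by rewrite gx isoK.
have gK : cancel h g.
  move=> x; pose i := maxn x.+1 (h x).+1.
  have [_ hx] : g x = val (f i) x /\ h x = val (iso_inv (f i)) x.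
    by apply: gE; apply: leq_trans (ki _); rewrite leq_max leqnn.
  have [-> _] : g (h x) = val (f i) (h x) /\ h (h x) = val (iso_inv (f i)) (h x).
    by apply: gE; apply: leq_trans (ki _); rewrite leq_max leqnn orbT.
  by rewrite hx isoVK.
have gP : (g : nat -> nat) \in isos X X.
  rewrite inE; split; first by exists h.
  move=> R t; pose i := (\max_(x <- t) x).+1.
  rewrite -[RHS](iso_rel (f i)); congr (X R _); apply: val_inj => /=.
  apply/eq_in_map => x xt; have [|//] := gE i x; apply: leq_trans (ki _).
  by rewrite ltnS; apply: leq_bigmax_seq.
exists (exist _ g gP) => i x xi; have [gx hx] := gE i x xi; split=> //.
rewrite -hx; apply: (can_inj hK); rewrite gK.
exact: (isoVK (exist _ g gP : automorphisms X)).
Qed.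

Lemma iso_invE (L : signature) (X Y : structure L) (f : isos X Y) (g : isos Y X) :
  cancel (val g) (val f) -> iso_inv f = g.
Proof.
by move=> gK; apply: iso_ext => x; apply: (can_inj (isoK f)); rewrite isoVK gK.
Qed.

Lemma iso_invM (L : signature) (X Y Z : structure L) (g : isos Y Z) (f : isos X Y) :
  iso_inv (iso_comp g f) = iso_comp (iso_inv f) (iso_inv g).
Proof. by apply: iso_invE => x /=; rewrite !isoVK. Qed.

Lemma iso_invI (L : signature) (X Y : structure L) (f : isos X Y) :
  iso_inv (iso_inv f) = f.
Proof. by apply: iso_invE; exact: isoK. Qed.

Section OpenMapping.
Context (LB LA : signature) (B : structure LB) (A : structure LA).
Context (H : automorphisms B -> automorphisms A).
Hypothesis HM : {morph H : g f / iso_comp g f}.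

Lemma morph_iso_id : H (iso_id B) = iso_id A.
Proof.
apply: iso_ext => x; apply: (can_inj (isoK (H (iso_id B)))).
rewrite -[LHS]/(val (iso_comp (H (iso_id B)) (H (iso_id B))) x) -HM.
by congr (val (H _) x); exact: iso_ext.
Qed.

Lemma morph_iso_inv f : H (iso_inv f) = iso_inv (H f).
Proof.
apply/esym/iso_invE => x.
rewrite -[LHS]/(val (iso_comp (H f) (H (iso_inv f))) x) -HM.
rewrite (_ : iso_comp f (iso_inv f) = iso_id B) ?morph_iso_id //.
by apply: iso_ext => z /=; rewrite isoVK.
Qed.

Definition fixes (L : signature) (X : structure L) k (f : automorphisms X) :=
  forall x, x < k -> val f x = x.

Lemma fixes_inv (L : signature) (X : structure L) k (f : automorphisms X) :
  fixes k f -> fixes k (iso_inv f).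
Proof. by move=> fk x xk; rewrite -{1}(fk x xk) isoK. Qed.

(** As [(f v)^-1 = v^-1 f^-1], composing with [v] keeps [f] and its inverse unchanged below [k] when
    [v] fixes the points below [k] and their preimages under [f]. *)
Definition bound (L : signature) (X : structure L) (f : automorphisms X) k :=
  maxn k (\max_(x < k) val (iso_inv f) x).+1.

Lemma agree_fixes (L : signature) (X : structure L) k (f v : automorphisms X) :
  fixes (bound f k) v -> agree k f (iso_comp f v).
Proof.
move=> fv x xk; rewrite iso_invM /=; split.
  by rewrite fv // leq_max xk.
rewrite (fixes_inv fv) //; apply: leq_trans (leq_maxr _ _).
by rewrite ltnS (@leq_bigmax _ (fun x : 'I_k => val (iso_inv f) x) (Ordinal xk)).
Qed.

(* Baire category: [Aut A] is covered by the images of the countably many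
   cosets of the stabilizer of the first [n] points, so one image is dense
   somewhere. *)
Lemma almost_open n : (forall g, exists f, H f = g) ->
  exists m, forall g : automorphisms A, fixes m g -> forall k, exists v,
    fixes n v /\ forall x, x < k -> val (H v) x = val g x.
Proof.
move=> surjH.
pose coset (t : seq nat) (h : automorphisms B) :=
  forall x, x < n -> val h x = nth 0 t x.
have [t [g0 [k0 dense]]] : exists t g0 k0, forall g, agree k0 g0 g ->
    forall k, exists h, coset t h /\ agree k g (H h).
  apply: contrapT => nodense.
  (* Otherwise every ball can be shrunk to one that misses the image of a given coset. *)
  have /choice[next nextP] (q : seq nat * (automorphisms A * nat)) :
      exists r : automorphisms A * nat,
      [/\ agree q.2.2 q.2.1 r.1, q.2.2 < r.2 &
          forall h, coset q.1 h -> ~ agree r.2 r.1 (H h)].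
    case: q => t [g k] /=; apply: contrapT => no; apply: nodense.
    exists t, g, k => g' gg' k'; apply: contrapT => noh; apply: no.
    exists (g', maxn k.+1 k') => /=; split=> //; first exact: leq_maxl.
    move=> h th hn; apply: noh; exists h; split=> //.
    by apply: agreeW hn; exact: leq_maxr.
  pose st := fix st i := if i is j.+1 then
    next (odflt [::] (unpickle j), st j) else (iso_id A, 0).
  have stS i : [/\ agree (st i).2 (st i).1 (st i.+1).1, (st i).2 < (st i.+1).2 &
      forall h, coset (odflt [::] (unpickle i)) h ->
        ~ agree (st i.+1).2 (st i.+1).1 (H h)].
    exact: nextP (_, _).
  have [|||g gP] := @agree_limit _ _ (fun i => (st i).1) (fun i => (st i).2).
  - by elim=> // i /leq_ltn_trans; apply; case: (stS i).
  - by move=> i; case: (stS i) => _ /ltnW.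
  - by move=> i; case: (stS i).
  (* The limit [g] is some [H h], yet stage [pickle t] excluded the coset given by the prefix [t] of
     [h]. *)
  have [h hg] := surjH g; pose t := mkseq (val h) n.
  case: (stS (pickle t)) => _ _ /(_ h); rewrite pickleK /=; apply.
    by move=> x xn; rewrite nth_mkseq.
  by rewrite hg; exact: (gP (pickle t).+1).
have [h0 [th0 h0g]] := dense _ (@agree_refl _ _ k0 g0) k0.
(* Translation by [H h0] moves [g] into the ball where the coset is dense; the quotient of two
   elements of one coset fixes the first [n] points. *)
exists (bound (H h0) k0) => g /agree_fixes /(agree_trans h0g) gg k.
have [h [th hg]] := dense _ gg k.
exists (iso_comp (iso_inv h0) h); split=> x xk /=.
  by rewrite th // -th0 // isoK.
by rewrite HM /= (hg x xk).1 /= morph_iso_inv isoK.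
Qed.

(* [y = H (a b^-1)] is solved by successive corrections on the right of [a] and
   of [b] in turn: the precision needed to correct one of them depends only on
   the current value of the other. *)
Lemma open_morphism n : (forall g, exists f, H f = g) -> continuous H ->
  exists m, forall y : automorphisms A, fixes m y -> exists h, fixes n h /\ H h = y.
Proof.
move=> surjH cH.
have /choice[M0 M0P] := fun n => almost_open n surjH.
(* The maximum makes the range on which the error is trivial grow with the stage. *)
pose M k := maxn (M0 k) k.
have MP k (g : automorphisms A) : fixes (M k) g -> forall j, exists v,
    fixes k v /\ forall x, x < j -> val (H v) x = val g x.
  by move=> gM; apply: M0P => x xM; apply: gM; rewrite leq_max xM.
(* Trivial exactly when [y = H (a b^-1)]. Inverting the error exchanges [a] and [b], so one
   correction step serves both sides. *)
pose err y a b := iso_comp (iso_inv (H a)) (iso_comp y (H b)).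
have errV y a b k : fixes k (err y a b) -> fixes k (err (iso_inv y) b a).
  move=> /fixes_inv; congr (fixes _ _).
  by apply: iso_ext => x; rewrite /err !iso_invM iso_invI.
have half y a b k j : fixes (M k) (err y a b) ->
    exists v, fixes k v /\ fixes j (err y (iso_comp a v) b).
  move=> /MP/(_ j)[v [vk vE]]; exists v; split=> // x xj.
  have := vE x xj; rewrite /err /= HM iso_invM /= => <-.
  by rewrite isoK.
exists (M (bound (iso_id B) n)) => y yM.
(* The error is small enough for the next correction of [a] to preserve [a] and its inverse below
   [n + i]. *)
pose P i (ab : automorphisms B * automorphisms B) :=
  fixes (M (bound ab.1 (n + i))) (err y ab.1 ab.2).
have /choice[next nextP] (q : nat * (automorphisms B * automorphisms B)) :
    exists ab', P q.1 q.2 -> [/\ P q.1.+1 ab', agree (n + q.1) q.2.1 ab'.1 &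
                               agree (n + q.1) q.2.2 ab'.2].
  case: q => i [a b] /=; have [Pi|nP] := pselect (P i (a, b)); last by exists (a, b).
  (* The precision reached by correcting [a] is the one that correcting [b] requires; the precision
     for [b], computed from the new [a], restores the invariant. *)
  have [v [va vE]] := half _ _ _ _ (M (bound b (n + i))) Pi.
  have [u [ub uE]] :=
    half _ _ _ _ (M (bound (iso_comp a v) (n + i.+1))) (errV _ _ _ _ vE).
  exists (iso_comp a v, iso_comp b u) => _; split=> /=; try exact: agree_fixes.
  by move/errV: uE; rewrite iso_invI.
pose st := fix st i := if i is j.+1 then next (j, st j) else (iso_id B, iso_id B).
have stP i : P i (st i).
  elim: i => [|i /(nextP (i, st i))[]//].
  move=> x; rewrite /= addn0 => xM; rewrite /err morph_iso_id /=.
  by rewrite yM // iso_inv_id.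
have stS i : [/\ P i.+1 (st i.+1), agree (n + i) (st i).1 (st i.+1).1 &
      agree (n + i) (st i).2 (st i.+1).2].
  exact: (nextP (i, st i)).
have [|||a aP] := @agree_limit _ _ (fun i => (st i).1) (addn n).
- by move=> i; rewrite leq_addl.
- by move=> i; rewrite leq_add2l.
- by move=> i; case: (stS i).
have [|||b bP] := @agree_limit _ _ (fun i => (st i).2) (addn n).
- by move=> i; rewrite leq_addl.
- by move=> i; rewrite leq_add2l.
- by move=> i; case: (stS i).
(* Continuity of [H] at both limits turns the vanishing errors into an equality. *)
have abE x : val y (val (H b) x) = val (H a) x.
  have [ma maP] := @continuous_prefix _ _ _ _ H a x.+1 (cH a).
  have [mb mbP] := @continuous_prefix _ _ _ _ H b x.+1 (cH b).
  pose i := maxn x.+1 (maxn ma mb).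
  rewrite -(maP (st i).1) //; last first.
    move=> z zm; have [] // := aP i z; apply: leq_trans (leq_addl _ _).
    by rewrite !leq_max zm !orbT.
  rewrite -(mbP (st i).2) //; last first.
    move=> z zm; have [] // := bP i z; apply: leq_trans (leq_addl _ _).
    by rewrite !leq_max zm !orbT.
  rewrite -[LHS](isoVK (H (st i).1)); congr (val _ _); apply: (stP i).
  apply: leq_trans (leq_maxr _ _); apply: leq_trans (leq_maxl _ _).
  by apply: leq_trans (leq_addl _ _); rewrite leq_max leqnn.
(* Both sequences start at the identity with agreement below [n], so both limits fix these
   points. *)
exists (iso_comp a (iso_inv b)); split.
  move=> x xn /=; have xn0 : x < n + 0 by rewrite addn0.
  have [_ ->] := bP 0 x xn0; rewrite /= iso_inv_id /=.
  by have [-> _] := aP 0 x xn0.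
by apply: iso_ext => x; rewrite HM /= -abE morph_iso_inv isoVK.
Qed.

End OpenMapping.

(** * Borel conditions on coded objects *)

Definition borel (D : set cantor_space) : Prop :=
  measurable (D : set (g_sigma_algebraType (@open cantor_space))).

(** Borel relative to codes: [D] is arbitrary off the range of [code], which may itself have any
    complexity. *)
Definition borel_in (T : Type) (code : T -> cantor_space) (Q : T -> Prop) : Prop :=
  exists D, borel D /\ forall x, Q x <-> D (code x).

Section BorelIn.
Context (T : Type) (code : T -> cantor_space).

Lemma borel_in_ext (P Q : T -> Prop) :
  (forall x, P x <-> Q x) -> borel_in code P -> borel_in code Q.
Proof. by move=> PQ [D [mD DE]]; exists D; split=> // x; rewrite -PQ. Qed.

Lemma borel_in_cst (P : Prop) : borel_in code (fun=> P).
Proof.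
have [p|np] := pselect P.
  by exists setT; split=> //; exact: measurableT.
by exists set0; split=> //; exact: measurable0.
Qed.

Lemma borel_in_not (Q : T -> Prop) :
  borel_in code Q -> borel_in code (fun x => ~ Q x).
Proof.
case=> D [mD DE]; exists (~` D); split; first exact: measurableC.
by move=> x; rewrite DE.
Qed.

Lemma borel_in_ex (I : countType) (Q : I -> T -> Prop) :
  (forall i, borel_in code (Q i)) -> borel_in code (fun x => exists i, Q i x).
Proof.
move=> /choice[D DP]; exists (\bigcup_i D i); split.
  by apply: countable_bigcupT_measurable => // i; case: (DP i).
move=> x; split=> [[i]|[i _]]; first by rewrite (DP i).2; exists i.
by rewrite -(DP i).2; exists i.
Qed.

Lemma borel_in_all (I : countType) (Q : I -> T -> Prop) :
  (forall i, borel_in code (Q i)) -> borel_in code (fun x => forall i, Q i x).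
Proof.
move=> bQ; apply: borel_in_ext (borel_in_not (borel_in_ex (fun i => borel_in_not (bQ i)))).
by move=> x; rewrite -forallNE; split=> h i; [exact: contrapT (h i)|apply; exact: h].
Qed.

Lemma borel_in_and (P Q : T -> Prop) :
  borel_in code P -> borel_in code Q -> borel_in code (fun x => P x /\ Q x).
Proof.
case=> D [mD DE] [E [mE EE]]; exists (D `&` E); split; first exact: measurableI.
by move=> x; rewrite DE EE.
Qed.

Lemma borel_in_or (P Q : T -> Prop) :
  borel_in code P -> borel_in code Q -> borel_in code (fun x => P x \/ Q x).
Proof.
case=> D [mD DE] [E [mE EE]]; exists (D `|` E); split; first exact: measurableU.
by move=> x; rewrite DE EE.
Qed.

Lemma borel_in_imp (P : Prop) (Q : T -> Prop) :
  (P -> borel_in code Q) -> borel_in code (fun x => P -> Q x).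
Proof.
have [p|np] := pselect P => bQ.
  by apply: borel_in_ext (bQ p) => x; split=> // /(_ p).
by apply: borel_in_ext (borel_in_cst True).
Qed.

Lemma borel_in_bit n : borel_in code (fun x => code x n).
Proof.
exists [set z | z n]; split=> //; apply: sub_sigma_algebra.
have cn : continuous (proj n : cantor_space -> bool) := @proj_continuous nat (fun=> bool) n.
by apply: (iffLR (continuousP _) cn [set true]); exact: discrete_open.
Qed.

End BorelIn.

(** An open set is a countable union of cylinders, so control of single output bits is enough. *)
Lemma borel_operatorP (Phi : cantor_space -> cantor_space) :
  (forall n, borel_in id (fun z => Phi z n)) -> borel_operator Phi.
Proof.
move=> bPhi; rewrite /borel_operator.
apply: (@measurability _ _ _ (g_sigma_algebraType (@open cantor_space)) _ _
  (@open cantor_space)) => // _ [U oU <-].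
rewrite setTI.
have [D [mD DE]] : borel_in id (fun z => exists s : seq bool,
    (forall y : cantor_space, (forall i, i < size s -> y i = nth false s i) -> U y)
    /\ forall i, i < size s -> Phi z i = nth false s i).
  apply: borel_in_ex => s; apply: borel_in_and; first exact: borel_in_cst.
  apply: borel_in_all => i; apply: borel_in_imp => _.
  case: (nth _ _ _); first exact: bPhi.
  by apply: borel_in_ext (borel_in_not (bPhi i)) => z; split => [/negP/negbTE|->].
rewrite (_ : _ @^-1` _ = D) //; apply/seteqP; split=> z; rewrite -(DE z).
  move=> /= Uz; have /ptws_nbhs_prefix[n nU] : nbhs (Phi z) U by exact: open_nbhs_nbhs.
  exists (mkseq (Phi z) n); rewrite size_mkseq; split=> [y yP|i lin]; last by rewrite nth_mkseq.
  by apply: nU => i lin; rewrite yP // nth_mkseq.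
by case=> s [+ zs]; apply.
Qed.

Lemma borel_operator_of_bits (T : Type) (code out : T -> cantor_space) :
  (forall n, borel_in code (fun x => out x n)) ->
  exists Phi, borel_operator Phi /\ forall x, Phi (code x) = out x.
Proof.
move=> /choice[D DP]; exists (fun z n => `[< D n z >]); split.
  apply: borel_operatorP => n; exists (D n); split; first by case: (DP n).
  by move=> z; split=> /asboolP.
move=> x; apply/funext => n.
by apply/asboolP/idP => /(DP n).2.
Qed.

Lemma borel_in_reindex (S T : Type) (code : T -> cantor_space)
    (code' : S -> cantor_space) (phi : S -> T) (p : nat -> nat) (Q : T -> Prop) :
  (forall s, code (phi s) = (fun n => code' s (p n))) ->
  borel_in code Q -> borel_in code' (fun s => Q (phi s)).
Proof.
move=> codeE [D [mD DE]]; pose Phi (z : cantor_space) : cantor_space := fun n => z (p n).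
have bPhi : borel_operator Phi by apply: borel_operatorP => n; exact: borel_in_bit.
exists (Phi @^-1` D); split; last by move=> s; rewrite DE codeE.
by rewrite -[X in borel X]setTI; exact: bPhi.
Qed.

(** * Borel selection of isomorphisms *)

Section TupleTypes.
Context (L : signature) (B : structure L).

(* A semantic substitute for the formulas of L_{omega_1 omega}. *)
Definition invariant_family (P : structure L -> seq nat -> Prop) : Prop :=
  (forall X Y (f : isos X Y) s, P X s <-> P Y (map (val f) s)) /\
  forall s, borel_in (@diagram L) (P^~ s).

Lemma invariant_family_not P :
  invariant_family P -> invariant_family (fun X s => ~ P X s).
Proof.
case=> iP bP; split=> [X Y f s|s]; first by rewrite (iP _ _ f).
exact: borel_in_not.
Qed.

Definition tuple_equiv (s t : seq nat) : Prop :=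
  forall P, invariant_family P -> (P B s <-> P B t).

Lemma tuple_equiv_sym s t : tuple_equiv s t -> tuple_equiv t s.
Proof. by move=> st P iP; rewrite (st P iP). Qed.

Lemma separating_family s t : ~ tuple_equiv s t ->
  exists P, [/\ invariant_family P, P B s & ~ P B t].
Proof.
move=> /existsNP[P /not_implyP[iP]].
have [Ps|nPs] := pselect (P B s) => nst.
  by exists P; split=> // Pt; apply: nst.
exists (fun X u => ~ P X u); split=> //; first exact: invariant_family_not.
by move=> nPt; apply: nst; split.
Qed.

(** If each [d] failed through some [Q d], the family saying that some [y] satisfies all [Q d] would
    hold of [s] by [y = c], hence of [t]; a witness [y] for [t] then contradicts the choice of
    [Q y]. *)
Lemma tuple_equiv_extend s t c : tuple_equiv s t ->
  exists d, tuple_equiv (rcons s c) (rcons t d).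
Proof.
move=> st; apply: contrapT => no.
have /choice[Q QP] d : exists P,
    [/\ invariant_family P, P B (rcons s c) & ~ P B (rcons t d)].
  by apply: separating_family => e; apply: no; exists d.
pose P X u := exists y, forall d, Q d X (rcons u y).
have iP : invariant_family P.
  split=> [X Y f u|u].
    split=> [[y Qy]|[y Qy]].
      exists (val f y) => d; rewrite -map_rcons.
      by case: (QP d) => -[iQ _] _ _; rewrite -iQ.
    exists (val (iso_inv f) y) => d; case: (QP d) => -[iQ _] _ _.
    by rewrite (iQ _ _ f) map_rcons isoVK.
  apply: borel_in_ex => y; apply: borel_in_all => d.
  by case: (QP d) => -[_ bQ] _ _; exact: bQ.
have /(st P iP)[y /(_ y)] : P B s by exists c => d; case: (QP d).
by case: (QP y).
Qed.

(** There are countably many [t], so the conjunction of the families separating [s] from the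
    inequivalent ones is again invariant. *)
Lemma isolating_family s :
  exists P, invariant_family P /\ forall t, P B t <-> tuple_equiv s t.
Proof.
have /choice[Q QP] t : exists P, ~ tuple_equiv s t ->
    [/\ invariant_family P, P B s & ~ P B t].
  have [st|/separating_family[P PP]] := pselect (tuple_equiv s t).
    by exists (fun _ _ => True).
  by exists P.
exists (fun X u => forall t, ~ tuple_equiv s t -> Q t X u); split.
  split=> [X Y f u|u].
    split=> h t nst; have [[iQ _] _ _] := QP t nst; first by rewrite -iQ; exact: h.
    by rewrite (iQ _ _ f); exact: h.
  apply: borel_in_all => t; apply: borel_in_imp => nst.
  by have [[_ bQ] _ _] := QP t nst; exact: bQ.
move=> t; split=> [h|st u nsu].
  by apply: contrapT => nst; have [_ _] := QP t nst; apply; exact: h.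
by have [iQ Qs _] := QP u nsu; rewrite -(st _ iQ).
Qed.

Lemma tuple_equiv_eq s t i j : tuple_equiv s t -> size s = size t ->
  i < size s -> j < size s -> (nth 0 s i = nth 0 s j <-> nth 0 t i = nth 0 t j).
Proof.
move=> st szst si sj.
(* The index bounds belong to the family because isomorphisms need not preserve the default 0 of
   [nth]. *)
pose P (X : structure L) u := i < size u /\ j < size u /\ nth 0 u i = nth 0 u j.
have iP : invariant_family P.
  split=> [X Y f u|u]; last exact: borel_in_cst.
  rewrite /P size_map; split=> -[iu [ju]]; rewrite !(nth_map 0) // => E;
    do 2!split=> //; first by rewrite E.
  exact: (can_inj (isoK f)).
have := st P iP; rewrite /P -szst si sj => -[st1 st2].
by split=> E; [case: st1 => // _ []|case: st2 => // _ []].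
Qed.

Lemma tuple_equiv_rel s t (R : symbol L) (idx : (symbol_arity R).-tuple nat) :
  tuple_equiv s t -> size s = size t -> (forall i, i \in idx -> i < size s) ->
  @B R (map_tuple (nth 0 s) idx) = @B R (map_tuple (nth 0 t) idx).
Proof.
move=> st szst idxs.
pose P (X : structure L) u :=
  (forall i, i \in val idx -> i < size u) /\ X R (map_tuple (nth 0 u) idx).
have iP : invariant_family P.
  split=> [X Y f u|u].
    have E : (forall i, i \in val idx -> i < size u) ->
        Y R (map_tuple (nth 0 (map (val f) u)) idx) = X R (map_tuple (nth 0 u) idx).
      move=> iu; rewrite -(iso_rel f); congr (Y R _); apply: val_inj => /=.
      by rewrite -map_comp; apply/eq_in_map => i /iu; exact: nth_map.
    by rewrite /P size_map; split=> -[iu]; [rewrite E|rewrite -E].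
  apply: borel_in_and; first exact: borel_in_cst.
  pose a : {R : symbol L & (symbol_arity R).-tuple nat} :=
    existT _ R (map_tuple (nth 0 u) idx).
  apply: borel_in_ext (borel_in_bit (@diagram L) (pickle a)) => X.
  by rewrite /diagram pickleK.
have := st P iP; rewrite /P -szst => -[st1 st2].
by apply/idP/idP => E; [case: st1|case: st2].
Qed.

End TupleTypes.

(** The default 0 makes the construction total, hence Borel on all structures and not only on copies
    of [B]. *)
Definition least (Q : nat -> Prop) : nat :=
  if pselect (exists n, `[< Q n >]) is left e then ex_minn e else 0.

Lemma leastP (Q : nat -> Prop) : (exists n, Q n) -> Q (least Q).
Proof.
case=> n Qn; rewrite /least; case: pselect => [e|[]]; last by exists n; apply/asboolP.
by case: ex_minnP => m /asboolP.
Qed.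

Lemma borel_in_least (T : Type) (code : T -> cantor_space) (Q : nat -> T -> Prop) m :
  (forall k, borel_in code (Q k)) ->
  borel_in code (fun x => least (Q^~ x) = m).
Proof.
move=> bQ.
apply: (@borel_in_ext _ _ (fun x => (Q m x /\ forall k, k < m -> ~ Q k x) \/
                            (m = 0 /\ forall k, ~ Q k x))); last first.
  apply: borel_in_or; apply: borel_in_and => //.
  - by apply: borel_in_all => k; apply: borel_in_imp => _; exact: borel_in_not.
  - exact: borel_in_cst.
  - by apply: borel_in_all => k; exact: borel_in_not.
move=> x; rewrite /least; case: pselect => [e|ne].
  case: ex_minnP => n /asboolP Qn nmin; split=> [[[Qm mmin]|[_ no]]|<-].
  - apply/eqP; rewrite eqn_leq nmin ?andTb; last exact/asboolP.
    by rewrite leqNgt; apply/negP => /mmin.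
  - by have := no _ Qn.
  - left; split=> // k kn Qk; move: kn; rewrite ltnNge nmin //; exact/asboolP.
split=> [[[Qm _]|[]//]|<-]; first by case: ne; exists m; apply/asboolP.
by right; split=> // k Qk; case: ne; exists k; apply/asboolP.
Qed.

(** * Back-and-forth between a structure and its copies *)

Section BackAndForth.
Context (L : signature) (B : structure L).

Lemma isolating_families : exists T : seq nat -> structure L -> seq nat -> Prop,
  forall s, invariant_family (T s) /\ forall t, T s B t <-> tuple_equiv B s t.
Proof. by have /choice[T TP] := isolating_family B; exists T. Qed.

(** The isolating families of [B], evaluated in any structure: types in a copy are read off its
    diagram, without an isomorphism to [B]. *)
Definition tuple_type : seq nat -> structure L -> seq nat -> Prop :=
  sval (cid isolating_families).

Lemma tuple_typeP (X : structure L) (g : isos X B) s u :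
  tuple_type s X u <-> tuple_equiv B s (map (val g) u).
Proof.
rewrite /tuple_type; case: cid => T TP /=; have [[iT _] TB] := TP s.
by rewrite (iT _ _ g) TB.
Qed.

Lemma borel_tuple_type s u : borel_in (@diagram L) (fun X => tuple_type s X u).
Proof. by rewrite /tuple_type; case: cid => T TP /=; have [[_ bT] _] := TP s. Qed.

Definition partial_iso (X : structure L) (p : seq (nat * nat)) : Prop :=
  tuple_type (unzip1 p) X (unzip2 p).

Definition pair_of (k : nat) : nat * nat := odflt (0, 0) (unpickle k).

(* At even stages the next element of [B] is matched, at odd stages the next
   element of [X]. *)
Definition candidate (X : structure L) n p k : Prop :=
  (if odd n then (pair_of k).2 else (pair_of k).1) = n./2 /\
  partial_iso X (rcons p (pair_of k)).

Fixpoint stage (X : structure L) n : seq (nat * nat) :=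
  if n is m.+1
  then rcons (stage X m) (pair_of (least (candidate X m (stage X m))))
  else [::].

Definition matched X n : nat * nat := pair_of (least (candidate X n (stage X n))).

Lemma stageE X n : stage X n = mkseq (matched X) n.
Proof. by elim: n => //= n IH; rewrite mkseqS -IH. Qed.

(** Countable quantification over the previous stage and the chosen code leaves a least choice for a
    fixed finite sequence. *)
Lemma borel_stage n p : borel_in (@diagram L) (fun X => stage X n = p).
Proof.
elim: n p => [|n IH] p /=; first exact: borel_in_cst.
apply: (@borel_in_ext _ _ (fun X => exists qk : seq (nat * nat) * nat,
    stage X n = qk.1 /\ (least (candidate X n qk.1) = qk.2 /\
    rcons qk.1 (pair_of qk.2) = p))).
  move=> X; split=> [[[q k] /= [-> [-> //]]]|<-].
  by exists (stage X n, least (candidate X n (stage X n))).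
apply: borel_in_ex => -[q k]; apply: borel_in_and; first exact: IH.
apply: borel_in_and; last exact: borel_in_cst.
apply: (@borel_in_least _ _ (fun k X => candidate X n q k)) => j.
apply: borel_in_and; first exact: borel_in_cst.
exact: borel_tuple_type.
Qed.

Lemma borel_matched n x : borel_in (@diagram L) (fun X => matched X n = x).
Proof.
apply: (@borel_in_ext _ _ (fun X => exists p, stage X n.+1 = p /\ last x p = x)).
  by move=> X /=; split=> [[_ [<-]]|<-]; [|exists (stage X n.+1)]; rewrite /= last_rcons.
apply: borel_in_ex => p; apply: borel_in_and; first exact: borel_stage.
exact: borel_in_cst.
Qed.

Section Isomorphic.
Context (X : structure L) (g : isos X B).

Lemma partial_iso_nil : partial_iso X [::].
Proof. by apply/(tuple_typeP g) => P _. Qed.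

(** The extension property supplies a partner on either side, at odd stages after exchanging the
    tuples. The isomorphism [g] proves existence but does not enter the choice. *)
Lemma candidate_exists n p : partial_iso X p -> exists k, candidate X n p k.
Proof.
move=> /(tuple_typeP g) pe; rewrite /candidate.
suff [q [q1 q2]] : exists q : nat * nat,
    (if odd n then q.2 else q.1) = n./2 /\ partial_iso X (rcons p q).
  by exists (pickle q); rewrite /pair_of pickleK.
case: (odd n).
  have [c ce] := tuple_equiv_extend (val g n./2) (tuple_equiv_sym pe).
  exists (c, n./2); split=> //; apply/(tuple_typeP g).
  by rewrite /unzip1 /unzip2 !map_rcons; exact: tuple_equiv_sym.
have [d de] := tuple_equiv_extend n./2 pe.
exists (n./2, val (iso_inv g) d); split=> //; apply/(tuple_typeP g).
by rewrite /unzip1 /unzip2 !map_rcons /= isoVK.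
Qed.

Lemma partial_iso_stage n : partial_iso X (stage X n).
Proof.
elim: n => [|n /(candidate_exists n) /leastP[]//]; exact: partial_iso_nil.
Qed.

Lemma matched_coord n :
  (if odd n then (matched X n).2 else (matched X n).1) = n./2.
Proof. by have [] := leastP (candidate_exists n (partial_iso_stage n)). Qed.

Lemma matched1 x : (matched X x.*2).1 = x.
Proof. by have := matched_coord x.*2; rewrite odd_double doubleK. Qed.

Lemma matched2 x : (matched X x.*2.+1).2 = x.
Proof. by have := matched_coord x.*2.+1; rewrite /= odd_double uphalf_double. Qed.

Lemma stage_equiv n : tuple_equiv B (mkseq (fun i => (matched X i).1) n)
  (mkseq (fun i => val g (matched X i).2) n).
Proof.
have /(tuple_typeP g) := partial_iso_stage n.
by rewrite stageE /unzip1 /unzip2 /mkseq -!map_comp.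
Qed.

Lemma matched_eq i j :
  (matched X i).1 = (matched X j).1 <-> (matched X i).2 = (matched X j).2.
Proof.
pose n := (maxn i j).+1.
have iln : i < n by rewrite ltnS leq_maxl.
have jln : j < n by rewrite ltnS leq_maxr.
have := tuple_equiv_eq (i := i) (j := j) (stage_equiv n).
rewrite !size_mkseq !nth_mkseq // => -> //.
by split=> [/(can_inj (isoK g))|->].
Qed.

Definition match_map (x : nat) : nat := (matched X x.*2).2.

Lemma match_map_iso : (match_map : nat -> nat) \in isos B X.
Proof.
rewrite inE; split.
  (* Even stages exhaust [B], odd stages exhaust [X], and [matched_eq] makes the pairs the graph of
     an injection. *)
  exists (fun y => (matched X y.*2.+1).1) => x; rewrite /match_map.
    by rewrite -[RHS]matched1; apply/matched_eq; rewrite matched2.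
  by rewrite -[RHS]matched2; apply/matched_eq; rewrite matched1.
(* All entries of [t] are matched before stage [n], at the indices [double t]. *)
move=> R t; pose n := (\max_(x <- t) x.*2).+1.
have tn i : i \in map double t -> i < n.
  case/mapP => x xt ->; rewrite ltnS.
  exact: (@leq_bigmax_seq _ t xpredT double x).
have := @tuple_equiv_rel _ _ _ _ R (map_tuple double t) (stage_equiv n).
rewrite !size_mkseq => /(_ erefl tn) E.
rewrite -(iso_rel g); transitivity (@B R (map_tuple
    (nth 0 (mkseq (fun i => val g (matched X i).2) n)) (map_tuple double t))).
  congr (@B R _); apply: val_inj; rewrite /= -!map_comp.
  by apply/eq_in_map => x xt /=; rewrite nth_mkseq // tn // map_f.
rewrite -E; congr (@B R _); apply: val_inj; rewrite /= -!map_comp.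
rewrite -[RHS]map_id; apply/eq_in_map => x xt /=.
by rewrite nth_mkseq ?matched1 // tn // map_f.
Qed.

End Isomorphic.
End BackAndForth.

Lemma borel_selector (L : signature) (B : structure L) :
  exists s : forall X : Iso B, isos B X, s (Iso_self B) = iso_id B /\
  forall x y, borel_in (fun X : Iso B => diagram X) (fun X => val (s X) x = y).
Proof.
have isoX (X : Iso B) : exists f : isos X B, True.
  have [f fP] := set_mem (valP X).
  by exists (exist _ f (mem_set fP)).
have mP (X : Iso B) : (match_map B X : nat -> nat) \in isos B X.
  by have [g _] := isoX X; exact: match_map_iso g.
pose m (X : Iso B) : isos B X := exist _ (match_map B X) (mP X).
(* Precomposing with the inverse of the map built for [B] itself normalises the selector to the
   identity at [B]. *)
exists (fun X => iso_comp (m X) (iso_inv (m (Iso_self B)))); split.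
  by apply: iso_ext => x; exact: (isoVK (m (Iso_self B))).
move=> x y /=; set x' := val (iso_inv _) x.
have := borel_in_ex (fun z => borel_matched B x'.*2 (z, y)).
move=> /(borel_in_reindex (code' := fun X : Iso B => diagram X)
  (phi := fun X : Iso B => X : structure L) (p := id)) => /(_ (fun=> erefl)).
apply: borel_in_ext => X; rewrite /match_map; split=> [[z ->]//|<-].
by exists (matched B X x'.*2).1; rewrite -surjective_pairing.
Qed.

(** * Transport of isomorphisms along a morphism of automorphism groups *)

(** Translation makes [m] uniform in [f] and [g]: [f^-1 g] fixes the first [m] points, so its image
    under [K] fixes [x]. *)
Lemma prefix_determined (LB LA : signature) (B : structure LB) (A : structure LA)
    (K : automorphisms B -> automorphisms A) x :
  {morph K : g f / iso_comp g f} ->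
  (forall n, exists m, forall f, fixes m f -> fixes n (K f)) ->
  exists m, forall f g : automorphisms B,
    (forall i, i < m -> val f i = val g i) -> val (K f) x = val (K g) x.
Proof.
move=> KM /(_ x.+1)[m mP]; exists m => f g fg.
have /mP/(_ x (ltnSn x)) : fixes m (iso_comp (iso_inv f) g).
  by move=> i im; rewrite /= -fg // isoK.
by rewrite KM morph_iso_inv //= => /(congr1 (val (K f))); rewrite isoVK.
Qed.

Section Transport.
Context (LB LA : signature) (B : structure LB) (A : structure LA).
Context (K : automorphisms B -> automorphisms A).
Hypothesis KM : {morph K : g f / iso_comp g f}.
Context (s : forall X : Iso B, isos B X).

Definition pullback (X Y : Iso B) (f : isos X Y) : automorphisms B :=
  iso_comp (iso_inv (s Y)) (iso_comp f (s X)).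

Lemma transport_id (X : Iso B) : K (pullback (iso_id X)) = iso_id A.
Proof.
rewrite -(morph_iso_id KM); congr (K _); apply: iso_ext => x /=; exact: isoK.
Qed.

Lemma transport_comp (X Y Z : Iso B) (g : isos Y Z) (f : isos X Y) :
  K (pullback (iso_comp g f)) = iso_comp (K (pullback g)) (K (pullback f)).
Proof.
by rewrite -KM; congr (K _); apply: iso_ext => x; rewrite /= isoVK.
Qed.

Definition transport : functor B A :=
  @Functor _ _ B A (fun=> Iso_self A) (fun X Y f => K (pullback f))
    transport_id transport_comp.

Lemma borel_transport :
  (forall x y, borel_in (fun X : Iso B => diagram X) (fun X => val (s X) x = y)) ->
  (forall n, exists m, forall f, fixes m f -> fixes n (K f)) ->
  borel_functor transport.
Proof.
move=> bs Kc.
pose T := {X : Iso B & {Y : Iso B & isos X Y}}.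
pose src (w : T) := tag w.
pose tgt (w : T) := tag (tagged w).
pose arr (w : T) : isos (src w) (tgt w) := tagged (tagged w).
pose code (w : T) :=
  real_join (real_join (diagram (src w)) (graph_code (val (arr w)))) (diagram (tgt w)).
(* In the double join the source occupies positions [4n], the target [2n+1] and the arrow [4n+2]. *)
have bsrc x y : borel_in code (fun w => val (s (src w)) x = y).
  apply: (@borel_in_reindex _ _ _ _ src (fun n => n.*2.*2)) (bs x y) => w.
  by apply/funext => n; rewrite /code /real_join !(odd_double, doubleK).
have btgt x y : borel_in code (fun w => val (s (tgt w)) x = y).
  apply: (@borel_in_reindex _ _ _ _ tgt (fun n => n.*2.+1)) (bs x y) => w.
  by apply/funext => n; rewrite /code /real_join /= odd_double uphalf_double.
have barr x y : borel_in code (fun w => val (arr w) x = y).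
  apply: borel_in_ext (borel_in_bit code (pickle (x, y)).*2.+1.*2) => w.
  rewrite /code /real_join odd_double doubleK /= odd_double /= uphalf_double.
  by rewrite /graph_code pickleK; split=> /eqP.
have bpull x y : borel_in code (fun w => val (pullback (arr w)) x = y).
  apply: (@borel_in_ext _ _ (fun w => exists ab : nat * nat,
      val (s (src w)) x = ab.1 /\ (val (s (tgt w)) y = ab.2 /\ val (arr w) ab.1 = ab.2))).
    move=> w; split=> [[[a b] /= [-> [<- ->]]]|<-]; first by rewrite isoK.
    by exists (val (s (src w)) x, val (arr w) (val (s (src w)) x)); rewrite /= isoVK.
  by apply: borel_in_ex => ab; do 2!apply: borel_in_and => //.
have bK x y : borel_in code (fun w => val (K (pullback (arr w))) x = y).
  have [m mP] := prefix_determined x KM Kc.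
  (* The prefix [t] ranges over a countable set; the quantifier over automorphisms [h] involves [t]
     but not [w], so it is a constant condition. *)
  apply: (@borel_in_ext _ _ (fun w => exists t : seq nat,
      (forall i, i < m -> val (pullback (arr w)) i = nth 0 t i) /\
      exists h : automorphisms B, (forall i, i < m -> val h i = nth 0 t i) /\
        val (K h) x = y)).
    move=> w; split=> [[t [wt [h [ht <-]]]]|Ky].
      by apply: mP => i im; rewrite wt // ht.
    exists (mkseq (val (pullback (arr w))) m); split.
      by move=> i im; rewrite nth_mkseq.
    by exists (pullback (arr w)); split=> // i im; rewrite nth_mkseq.
  apply: borel_in_ex => t; apply: borel_in_and; last exact: borel_in_cst.
  by apply: borel_in_all => i; apply: borel_in_imp => _; exact: bpull.
have [|Psi [bPsi PsiE]] := @borel_operator_of_bits T code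
    (fun w => graph_code (val (K (pullback (arr w))))).
  move=> n; rewrite /graph_code; case: (unpickle n) => [[x y]|]; last exact: borel_in_cst.
  by apply: borel_in_ext (bK x y) => w; split=> /eqP.
exists (fun=> diagram A), Psi; split=> //.
  by apply: borel_operatorP => n; exact: borel_in_cst.
by move=> X Y f; exact: (PsiE (existT _ X (existT _ Y f))).
Qed.

Lemma borel_isos_inv :
  (forall x y, borel_in (fun X : Iso B => diagram X) (fun X => val (s X) x = y)) ->
  borel_isos (T := fun=> Iso_self B) (fun X => iso_inv (s X)).
Proof.
move=> bs; apply: borel_operator_of_bits => n; rewrite /graph_code.
case: (unpickle n) => [[x y]|]; last exact: borel_in_cst.
apply: borel_in_ext (bs y x) => X; split=> [<-|/eqP <-]; last by rewrite isoVK.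
by rewrite isoK.
Qed.

End Transport.

(** * Assembly of the adjoint equivalence *)

Theorem theorem2p4 (LA LB : signature) (A : structure LA) (B : structure LB)
    (H : automorphisms B -> automorphisms A)
    (H_iso : continuous_isomorphism H) :
  exists E : adjoint_equivalence B A,
    [/\ borel_adjoint_equivalence E,
        struct_of (functorF E (Iso_self B)) = A &
        forall h : automorphisms B,
          val (functor_map (functorF E) (X := Iso_self B) (Y := Iso_self B) h)
          = val (H h)].
Proof.
case: H_iso => HM [K HK KH] cH.
have KM : {morph K : g f / iso_comp g f}.
  by move=> g f; apply: (can_inj HK); rewrite HM !KH.
have [s [sB bs]] := borel_selector B; have [r [rA br]] := borel_selector A.
(* The normalisation of [s] at [B] is what makes [F] restrict to [H]. *)
have sE (h : automorphisms B) : pullback s (X := Iso_self B) (Y := Iso_self B) h = h.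
  by apply: iso_ext => x; rewrite /pullback sB iso_inv_id.
have rE (h : automorphisms A) : pullback r (X := Iso_self A) (Y := Iso_self A) h = h.
  by apply: iso_ext => x; rewrite /pullback rA iso_inv_id.
have cHn n : exists m, forall f, fixes m f -> fixes n (H f).
  have [m mP] := continuous_prefix n (cH (iso_id B)); exists m => f fm x xn.
  by rewrite (mP f) // morph_iso_id.
have cKn n : exists m, forall g, fixes m g -> fixes n (K g).
  have [g|m mP] := open_morphism HM n _ cH; first by exists (K g).
  by exists m => y /mP[h [hn <-]]; rewrite HK.
pose F := transport HM s; pose G := transport KM r.
have eps_nat (X Y : Iso A) (f : isos X Y) :
    iso_comp (functor_map F (functor_map G f)) (iso_inv (r X)) = iso_comp (iso_inv (r Y)) f.
  by apply: iso_ext => x; rewrite /= sE KH /= isoVK.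
have eta_nat (X Y : Iso B) (f : isos X Y) :
    iso_comp (functor_map G (functor_map F f)) (iso_inv (s X)) = iso_comp (iso_inv (s Y)) f.
  by apply: iso_ext => x; rewrite /= rE HK /= isoVK.
(* Both sides are the identity of [A]: the pullback of the unit is trivial, and [r] is the identity
   at [F X = A]. *)
have F_eta (X : Iso B) :
    functor_map F (Y := Iso_self B) (iso_inv (s X)) = iso_inv (r (F X)).
  rewrite rA iso_inv_id -(morph_iso_id HM); congr (H _).
  by apply: iso_ext => x; rewrite /= sB iso_inv_id /= isoK.
have G_eps (X : Iso A) :
    functor_map G (Y := Iso_self A) (iso_inv (r X)) = iso_inv (s (G X)).
  rewrite sB iso_inv_id -(morph_iso_id KM); congr (K _).
  by apply: iso_ext => x; rewrite /= rA iso_inv_id /= isoK.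
exists (AdjointEquivalence eps_nat eta_nat F_eta G_eps); split=> //.
- by split; [exact: borel_transport|exact: borel_transport|
    exact: borel_isos_inv|exact: borel_isos_inv].
- by move=> h /=; rewrite sE.
Qed.
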